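(* Let $n\ge 1$ be an integer. If a trihexagonal magic figure of order $n$ exists, then $\binom{n+1}{2}$ (equivalently, the number of vertices $3\binom{n+1}{2}$) is odd. Moreover, $\binom{n+1}{2}$ is odd if and only if $n\equiv 1$ or $2\pmod 4$.
   Context: The trihexagonal region of order $n\ge 1$, in barycentric coordinates: take the triangular array of points $(i,j,k)$ of nonnegative integers with $i+j+k=2n-1$ (an equilateral triangle with $2n$ points on each side), and remove all points whose three coordinates are all odd. The remaining set $V_n$ consists of the points with exactly two even coordinates and one odd coordinate; $|V_n|=\frac{3n(n+1)}{2}$. Let $e_1,e_2,e_3$ be the standard basis vectors. Faces of the region: - Upright triangular faces: the sets $\{P+e_1,P+e_2,P+e_3\}$, where $P$ is a triple of nonnegative even integers with coordinate sum $2n-2$. - Inverted triangular faces: the sets $\{Q-e_1,Q-e_2,Q-e_3\}$, where $Q$ is a triple of positive even integers with coordinate sum $2n$. - Hexagonal faces: for each removed point $c$ (a triple of positive odd integers with sum $2n-1$), the set of its six neighbours $c+e_a-e_b$, $a\neq b$. A trihexagonal magic figure of order $n$ is a bijection $\varphi:V_n\to\{1,2,\dots,\frac{3n(n+1)}{2}\}$ such that all triangular faces (upright and inverted) have the same sum $T_n$ of their three vertex labels, all hexagonal faces have the same sum $H_n$ of their six vertex labels, and $H_n=2T_n$. *)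

(* Defs.v *)
From mathcomp Require Import all_boot all_order all_algebra.
From mathcomp Require Import finmap zify.

Set Implicit Arguments.
Unset Strict Implicit.
Unset Printing Implicit Defensive.

Import Order.TTheory GRing.Theory Num.Theory.
Local Open Scope fset_scope.
Local Open Scope ring_scope.

Definition point := 'rV[int]_3.

Definition e (a : 'I_3) : point := delta_mx 0 a.

Definition nonneg (p : point) : bool := [forall a, 0 <= p 0 a].
Definition positive (p : point) : bool := [forall a, 0 < p 0 a].
Definition all_even (p : point) : bool := [forall a, (2 %| p 0%R a)%Z].
Definition all_odd (p : point) : bool := [forall a, ~~ (2 %| p 0%R a)%Z].
Definition coord_sum (p : point) : int := \sum_a p 0 a.

(* The box {0, .., 2n-1}^3 only serves to make the set finite: see in_array. *)
Definition array (n : nat) : {fset point} :=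
  [fset p in [seq (\row_a (f a)%:Z : point) | f : {ffun 'I_3 -> 'I_(2 * n)%N}]
   | coord_sum p == 2 * n%:Z - 1].

Lemma in_array n (p : point) :
  (p \in array n) = nonneg p && (coord_sum p == 2 * n%:Z - 1).
Proof.
rewrite !inE; case: eqP => [sp|_]; last by rewrite !andbF.
rewrite !andbT; apply/imageP/forallP => [[f _ ->] a|p0]; first by rewrite mxE.
have lt a : (`|p 0%R a| < 2 * n)%N.
  have pa : p 0 a <= 2 * n%:Z - 1.
    by rewrite -sp /coord_sum (bigD1 a) //= lerDl sumr_ge0.
  by have := p0 a; move: pa; move: (p _ a) => x; lia.
exists [ffun a => Ordinal (lt a)] => //.
by apply/rowP => a; rewrite mxE ffunE /= gez0_abs.
Qed.

Definition removed (n : nat) : {fset point} := [fset p in array n | all_odd p].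
Definition V (n : nat) : {fset point} := [fset p in array n | ~~ all_odd p].

Lemma in_removed n p : (p \in removed n) = (p \in array n) && all_odd p.
Proof. by rewrite inE. Qed.

Lemma in_V n p : (p \in V n) = (p \in array n) && ~~ all_odd p.
Proof. by rewrite inE. Qed.

Definition up_face (P : point) : {fset point} := [fset P + e a | a in 'I_3].
Definition down_face (Q : point) : {fset point} := [fset Q - e a | a in 'I_3].
Definition hex_face (c : point) : {fset point} :=
  [fset c + e ab.1 - e ab.2 | ab in [pred ab : 'I_3 * 'I_3 | ab.1 != ab.2]].

Definition up_base (n : nat) (P : point) : bool :=
  [&& nonneg P, all_even P & coord_sum P == 2 * n%:Z - 2].
Definition down_base (n : nat) (Q : point) : bool :=
  [&& positive Q, all_even Q & coord_sum Q == 2 * n%:Z].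

Lemma coord_sumD p q : coord_sum (p + q) = coord_sum p + coord_sum q.
Proof. by rewrite -big_split; apply: eq_bigr => a _; rewrite mxE. Qed.

Lemma coord_sumN p : coord_sum (- p) = - coord_sum p.
Proof. by rewrite -sumrN; apply: eq_bigr => a _; rewrite mxE. Qed.

Lemma coord_sum_e a : coord_sum (e a) = 1.
Proof.
rewrite /coord_sum (bigD1 a) //= mxE !eqxx big1 ?addr0 // => b /negbTE ba.
by rewrite mxE ba andbF.
Qed.

Lemma e_coord a b : e a 0 b = (b == a)%:R.
Proof. by rewrite mxE eqxx. Qed.

Lemma exists_neq (a : 'I_3) : exists b : 'I_3, b != a.
Proof.
by case: (eqVneq a ord0) => [->|]; [exists ord_max | exists ord0; rewrite eq_sym].
Qed.

Lemma up_face_sub n P : up_base n P -> up_face P `<=` V n.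
Proof.
case/and3P=> /forallP P0 /forallP Pe /eqP Ps.
apply/fsubsetP => _ /imfsetP[/= a _ ->]; rewrite in_V in_array.
rewrite coord_sumD coord_sum_e Ps; apply/andP; split; first (apply/andP; split).
- by apply/forallP => b; rewrite mxE e_coord addr_ge0 ?ler0n.
- by apply/eqP; lia.
have [b ba] := exists_neq a.
apply/forallPn; exists b; rewrite negbK mxE e_coord (negbTE ba) addr0; exact: Pe.
Qed.

Lemma down_face_sub n Q : down_base n Q -> down_face Q `<=` V n.
Proof.
case/and3P=> /forallP Q0 /forallP Qe /eqP Qs.
apply/fsubsetP => _ /imfsetP[/= a _ ->]; rewrite in_V in_array.
rewrite coord_sumD coord_sumN coord_sum_e Qs.
apply/andP; split; first (apply/andP; split).
- apply/forallP => b; rewrite 2!mxE e_coord.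
  by have := Q0 b; move: (Q 0 b) => x; case: (b == a) => /=; lia.
- by apply/eqP; lia.
have [b ba] := exists_neq a.
apply/forallPn; exists b; rewrite negbK 2!mxE e_coord (negbTE ba) subr0.
exact: Qe.
Qed.

Lemma hex_face_sub n c : c \in removed n -> hex_face c `<=` V n.
Proof.
rewrite in_removed in_array => /andP[/andP[/forallP c0 /eqP cs] /forallP co].
apply/fsubsetP => _ /imfsetP[/= [a b] /= ab ->]; rewrite in_V in_array.
rewrite !coord_sumD coord_sumN !coord_sum_e cs.
apply/andP; split; first (apply/andP; split).
- apply/forallP => d; rewrite mxE [X in X + _]mxE [X in _ + X]mxE !e_coord.
  have := c0 d; have := co d; move: (c 0 d) => x.
  by case: (d == a); case: (d == b) => /=; lia.
- by apply/eqP; lia.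
apply/forallPn; exists a; rewrite mxE [X in X + _]mxE [X in _ + X]mxE !e_coord eqxx.
move: ab; rewrite /= => /negbTE ->; have := co a; move: (c 0 a) => x /=; lia.
Qed.

Definition labels (n : nat) : {fset nat} :=
  [fset m in iota 1 ((3 * n * (n + 1)) %/ 2)%N].

(* Every face is contained in V n (up_face_sub, down_face_sub, hex_face_sub),
   so the sum below ranges over all of F when F is a face. *)
Definition face_sum (n : nat) (phi : V n -> labels n) (F : {fset point}) : nat :=
  (\sum_(v : V n | val v \in F) val (phi v))%N.

Definition is_magic (n : nat) (phi : V n -> labels n) : Prop :=
  bijective phi /\
  exists T H : nat,
    [/\ forall P, up_base n P -> face_sum phi (up_face P) = T,
        forall Q, down_base n Q -> face_sum phi (down_face Q) = T,
        forall c, c \in removed n -> face_sum phi (hex_face c) = H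
      & H = (2 * T)%N].

(* Main.v *)
Require Import Defs.
From mathcomp Require Import all_boot all_order all_algebra.
From mathcomp Require Import finmap.
From mathcomp Require Import zify.

Set Implicit Arguments.
Unset Strict Implicit.
Unset Printing Implicit Defensive.

Local Open Scope nat_scope.
Local Open Scope fset_scope.

(** The upright triangles alone already decide the parity.  A point of the
    region has exactly one odd coordinate, and lowering that coordinate by one is
    the only way to reach the base point [P] of an upright face through it: the
    upright faces partition [V n] (in_up_face_tri_base).  Hence any sum over
    [V n] splits into sums over the upright faces (sum_up_faces).  Halving the
    coordinates of the base points identifies them with the triples of naturals
    of sum [n - 1], so there are [C = 'C(n + 1, 2)] faces (card_tri_index).

    Summing the constant 1 gives [#|V n| = 3 C].  Summing the labels of a magic
    figure gives [C T], which is also [1 + ... + 3 C], so that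
    [2 C T = 3 C (3 C + 1)].  Cancelling [C > 0] leaves [2 T = 3 (3 C + 1)]:
    [3 C + 1] is even and [C] is odd (magic_odd).  The residues of [n] modulo 4
    come from [2 C = n (n + 1)] (odd_bin2). *)

(** The coordinates are named [inord 0], [inord 1], [inord 2], a form that
    [inord_val] produces from any ordinal and [inordK] evaluates. *)
Lemma forall_ord3 (P : 'I_3 -> Prop) :
  (forall a, P a) <-> [/\ P (inord 0), P (inord 1) & P (inord 2)].
Proof.
split=> [PT | [P0 P1 P2] a]; first by split.
by rewrite -(inord_val a); case: a => [[|[|[|]]]].
Qed.

Lemma point_eqP (p q : point) :
  p = q <-> [/\ p 0%R (inord 0) = q 0%R (inord 0),
                p 0%R (inord 1) = q 0%R (inord 1)
              & p 0%R (inord 2) = q 0%R (inord 2)].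
Proof.
rewrite -(forall_ord3 (fun a => p 0%R a = q 0%R a)).
by split=> [-> // | eq_pq]; apply/rowP.
Qed.

Lemma coord_sum3 (p : point) :
  coord_sum p = (p 0 (inord 0) + p 0 (inord 1) + p 0 (inord 2))%R.
Proof.
rewrite /coord_sum 3!big_ord_recr big_ord0 /= GRing.add0r.
by congr (_ + _ + _)%R; congr (p _ _); apply/val_inj; rewrite /= inordK.
Qed.

(** The pairs [(i, j)] that extend to a triple [(i, j, m - i - j)] of naturals:
    with [n = m.+1], these triples are the halves of the base points of the
    upright faces, whose coordinates sum to [2 m]. *)
Definition tri_index (m : nat) : {pred 'I_m.+1 * 'I_m.+1} :=
  [pred ij : 'I_m.+1 * 'I_m.+1 | ij.1 + ij.2 <= m].
Arguments tri_index : clear implicits.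

Definition tri_base (m : nat) (ij : 'I_m.+1 * 'I_m.+1) : point :=
  (\row_a (nth 0 [:: 2 * ij.1; 2 * ij.2; 2 * (m - ij.1 - ij.2)] a)%N%:Z)%R.

Lemma tri_base_coord m (ij : 'I_m.+1 * 'I_m.+1) :
  [/\ tri_base ij 0%R (inord 0) = (2 * ij.1)%:Z%R,
      tri_base ij 0%R (inord 1) = (2 * ij.2)%:Z%R
    & tri_base ij 0%R (inord 2) = (2 * (m - ij.1 - ij.2))%:Z%R].
Proof. by split; rewrite mxE inordK. Qed.

Lemma tri_base_up m (ij : 'I_m.+1 * 'I_m.+1) :
  ij \in tri_index m -> up_base m.+1 (tri_base ij).
Proof.
rewrite inE => le_m; have [b0 b1 b2] := tri_base_coord ij.
apply/and3P; split.
- by apply/forallP => a; rewrite mxE.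
- by apply/forallP/forall_ord3; rewrite b0 b1 b2; split; lia.
- by rewrite coord_sum3 b0 b1 b2; lia.
Qed.

(** Reversing the order of the rows [i], the number of possible [j] becomes
    [i.+1], and the count is a triangular number. *)
Lemma card_tri_index m : #|tri_index m| = 'C(m.+1 + 1, 2).
Proof.
rewrite addn1 -sum1_card.
transitivity (\sum_(i < m.+1) \sum_(j < m.+1 | i + j <= m) 1).
  by rewrite pair_big_dep.
rewrite -bin2_sum big_nat_recl // add0n big_mkord (reindex_inj rev_ord_inj) /=.
apply: eq_bigr => i _.
rewrite -(big_mkord (fun j => m.+1 - i.+1 + j <= m) (fun=> 1)).
rewrite -[RHS]muln1 -[X in _ = X * 1]subn0 -sum_nat_const_nat.
rewrite [RHS](big_nat_widen _ _ m.+1) //; apply: eq_bigl => j.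
have := ltn_ord i; lia.
Qed.

(** The base point of the upright face through [v] is [v] with its odd coordinate
    lowered by one, so halving rounds down to the right index whichever
    coordinate is odd. *)
Definition tri_of (m : nat) (v : point) : 'I_m.+1 * 'I_m.+1 :=
  (inord (`|v 0%R (inord 0)|%N)./2, inord (`|v 0%R (inord 1)|%N)./2).

Lemma e_coord_inord (a b : nat) : a < 3 -> b < 3 ->
  e (inord a) 0%R (inord b) = ((b == a)%:Z)%R.
Proof.
move=> a3 b3; rewrite e_coord -val_eqE /= !inordK //; by case: eqP.
Qed.

(** The upright faces partition the region.  The coordinates of [v] have odd sum
    and are not all odd, so exactly one is odd; membership in the face then says
    that [v] exceeds the base point by one at that coordinate and nowhere else. *)
Lemma in_up_face_tri_base m (v : point) (ij : 'I_m.+1 * 'I_m.+1) : v \in V m.+1 ->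
  tri_of m v \in tri_index m /\
  (ij \in tri_index m -> (v \in up_face (tri_base ij)) = (tri_of m v == ij)).
Proof.
rewrite in_V in_array => /andP[/andP[/forallP/forall_ord3 v_ge0]].
rewrite coord_sum3 => /eqP v_sum /forallPn/= [d d_even].
have {d d_even} : [|| 2 %| v 0%R (inord 0), 2 %| v 0%R (inord 1)
                    | 2 %| v 0%R (inord 2)]%Z.
  apply: contraNT d_even; rewrite !negb_or => /and3P odd_v.
  exact: ((forall_ord3 (fun d => ~~ (2 %| v 0%R d)%Z)).2 odd_v).
have := point_eqP v _.
rewrite /tri_of; move: v_ge0 v_sum.
move: (v 0%R (inord 0)) (v 0%R (inord 1)) (v 0%R (inord 2)) => x y z.
move=> [x0 y0 z0] s vE some_even; split.
  by rewrite inE /= !inordK; lia.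
rewrite inE => le_m; have [b0 b1 b2] := tri_base_coord ij.
case: ij le_m b0 b1 b2 => i j /= le_m b0 b1 b2.
have lti := ltn_ord i; have ltj := ltn_ord j.
rewrite xpair_eqE -!val_eqE /= !inordK; [|lia|lia].
have addE (p q : point) b : ((p + q) 0 b = p 0 b + q 0 b)%R by rewrite mxE.
(* Reading off coordinates turns membership into linear equations, which the
   parities of [x], [y], [z] then settle. *)
have faceE (k : nat) : k < 3 ->
  v = (tri_base (i, j) + e (inord k))%R <->
  [/\ x = (2 * i)%:Z + (0%N == k)%:Z, y = (2 * j)%:Z + (1%N == k)%:Z
    & z = (2 * (m - i - j))%:Z + (2%N == k)%:Z]%R.
  by move=> k3; rewrite vE !addE !e_coord_inord // b0 b1 b2.
apply/imfsetP/andP => /= [[a _] | [/eqP ei /eqP ej]].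
  rewrite -(inord_val a) => /faceE-/(_ (ltn_ord a)).
  by case: a => [[|[|[|]]]] //= _ [-> -> _]; split; lia.
have [k k3 kE] : exists2 k, k < 3 &
  [/\ x = (2 * i)%:Z + (0%N == k)%:Z, y = (2 * j)%:Z + (1%N == k)%:Z
    & z = (2 * (m - i - j))%:Z + (2%N == k)%:Z]%R.
  (* The direction is forced to be that of the odd coordinate. *)
  by exists (if odd `|x| then 0 else if odd `|y| then 1 else 2);
    move: some_even; case: ifP => ox; try case: ifP => oy; rewrite //=;
    try split; lia.
by exists (inord k) => //; apply/faceE.
Qed.

Lemma sum_up_faces m (F : V m.+1 -> nat) :
  \sum_v F v
    = \sum_(ij in tri_index m) \sum_(v | val v \in up_face (tri_base ij)) F v.
Proof.
rewrite (partition_big (fun v => tri_of m (val v)) (mem (tri_index m))) /=.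
  apply: eq_bigr => ij ijD; apply: eq_bigl => v.
  by have [_ ->] := in_up_face_tri_base ij (valP v).
by move=> v _; have [] := in_up_face_tri_base (ord0, ord0) (valP v).
Qed.

Lemma e_inj : injective e.
Proof.
move=> a b /(congr1 (fun p : point => p 0%R a)).
by rewrite !e_coord eqxx; case: eqP.
Qed.

Lemma card_up_face P : #|` up_face P| = 3.
Proof.
rewrite card_imfset /= -?cardE ?card_ord //.
by move=> a b /(GRing.addrI P)/e_inj.
Qed.

Lemma card_V n : 1 <= n -> #|` V n| = 3 * 'C(n + 1, 2).
Proof.
case: n => // m _; rewrite -card_tri_index cardfE -sum1_card.
rewrite (sum_up_faces (fun=> 1)) mulnC -sum_nat_const.
apply: eq_bigr => ij /tri_base_up/up_face_sub face_sub.
rewrite sum1dep_card -[RHS](card_up_face (tri_base ij)) -(card_fsub face_sub).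
by apply: eq_card => v; rewrite !inE.
Qed.

Lemma mul2_bin2 n : 2 * 'C(n + 1, 2) = n * (n + 1).
Proof. by rewrite -mul_bin_diag addn1 bin1 mulnC. Qed.

(** The labels are [1, ..., N] with [N = 3 'C(n + 1, 2)], of sum [N (N + 1) / 2];
    doubling avoids the division. *)
Lemma sum_labels n (phi : V n -> labels n) : bijective phi ->
  2 * \sum_v val (phi v) = (3 * 'C(n + 1, 2)) * (3 * 'C(n + 1, 2) + 1).
Proof.
move=> phi_bij.
transitivity (2 * \sum_(l : labels n) val l).
  by congr (2 * _); rewrite [RHS](reindex phi) //; apply: onW_bij.
rewrite -(big_seq_fsetE _ _ xpredT id) /=.
have /(perm_big _)-> : perm_eq (labels n) (iota 1 (3 * 'C(n + 1, 2))).
  rewrite uniq_perm ?fset_uniq ?iota_uniq // => l.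
  by rewrite inE /= -mulnA -mul2_bin2 mulnCA mulKn.
transitivity (2 * 'C(3 * 'C(n + 1, 2) + 1, 2)).
  move: 'C(n + 1, 2) => C.
  by rewrite -bin2_sum addn1 [in RHS]big_ltn // add0n /index_iota subn1.
by rewrite mul2_bin2.
Qed.

(** Writing [n = 4 q + r], the product [n (n + 1)] is [r (r + 1)] modulo 4, and
    its half is odd exactly when [r (r + 1)] is 2 modulo 4. *)
Lemma odd_bin2 n : odd 'C(n + 1, 2) <-> n = 1 %[mod 4] \/ n = 2 %[mod 4].
Proof.
have := mul2_bin2 n; move: 'C(_, _) => C.
rewrite {1 2}(divn_eq n 4); move: (n %/ 4) (ltn_pmod n (isT : 0 < 4)) => q.
case: (n %% 4) => [|[|[|[|]]]] //= _ eqC;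
  by split; lia.
Qed.

(** Double counting of the sum of all labels, face by face and as an arithmetic
    progression. *)
Lemma magic_odd n (phi : V n -> labels n) :
  1 <= n -> is_magic phi -> odd 'C(n + 1, 2).
Proof.
case: n phi => // m phi _ [phi_bij [T [_ [upT _ _ _]]]].
have := sum_labels phi_bij.
rewrite sum_up_faces (eq_bigr (fun=> T)) => [|ij /tri_base_up/upT //].
rewrite sum_nat_const card_tri_index.
have : 0 < 'C(m.+1 + 1, 2) by rewrite bin_gt0 addn1.
move: 'C(_, _) => C C_gt0.
move=> sumT; have /eqP : C * (2 * T) = C * (3 * (3 * C + 1)) by lia.
rewrite eqn_pmul2l // => /eqP/(congr1 odd).
by rewrite !oddM oddD oddM /=; case: (odd C).
Qed.

Theorem proposition3p3 (n : nat) (hn : 1 <= n) :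
  [/\ (exists phi : V n -> labels n, is_magic phi) -> odd 'C(n + 1, 2),
      #|` V n| = 3 * 'C(n + 1, 2),
      odd 'C(n + 1, 2) <-> odd #|` V n|
    & odd 'C(n + 1, 2) <-> n = 1 %[mod 4] \/ n = 2 %[mod 4]].
Proof.
have cardV := card_V hn; split=> //; last exact: odd_bin2.
- by case=> phi; apply: magic_odd.
- by rewrite cardV oddM.
Qed.
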